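(* Let $A\in\mathbb{R}^{m\times n}$, $a\in\mathbb{R}^m$, $B\in\mathbb{R}^{l\times n}$, $b\in\mathbb{R}^l$, with $B$ of full row rank, and suppose the polyhedral set $\mathcal{P}=\{y\in\mathbb{R}^n \mid Ay\le a,\ By=b\}$ is nonempty. Let $\Pi_{\mathcal{P}}:\mathbb{R}^n\to\mathbb{R}^n$ be the Euclidean projection onto $\mathcal{P}$. Let $x\in\mathbb{R}^n$ be any given vector. Suppose the linear independence constraint qualification (LICQ) holds at $\Pi_{\mathcal{P}}(x)$. Then $$\partial_B\Pi_{\mathcal{P}}(x)=\partial_{HS}\Pi_{\mathcal{P}}(x).$$
   Context: Projection: $\Pi_{\mathcal{P}}(x)=\arg\min_{y\in\mathcal{P}}\frac12\|y-x\|_2^2$. $A_i$ denotes the $i$th row of $A$, and for $K\subseteq\{1,\dots,m\}$, $A_K$ is the matrix consisting of the rows of $A$ indexed by $K$. The active set is $I(x)=\{i\in\{1,\dots,m\}\mid A_i\Pi_{\mathcal{P}}(x)=a_i\}$. LICQ at $\Pi_{\mathcal{P}}(x)$: the rows $\{A_i\}_{i\in I(x)}$ together with all the rows of $B$ are linearly independent. KKT multipliers: $M(x)$ is the set of all $(\lambda,\mu)\in\mathbb{R}^m\times\mathbb{R}^l$ such that $\Pi_{\mathcal{P}}(x)-x+A^\top\lambda+B^\top\mu=0$, $A\Pi_{\mathcal{P}}(x)-a\le 0$, $B\Pi_{\mathcal{P}}(x)=b$, $\lambda\ge 0$, $\lambda^\top(A\Pi_{\mathcal{P}}(x)-a)=0$.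 Let $\mathrm{supp}(\lambda)=\{i\mid\lambda_i>0\}$ and $$\mathcal{E}(x)=\{K\subseteq\{1,\dots,m\}\mid \exists(\lambda,\mu)\in M(x)\text{ with }\mathrm{supp}(\lambda)\subseteq K\subseteq I(x),\ \text{and } [A_K^\top\ B^\top]\text{ has full column rank}\}.$$ HS-Jacobian: with $H_K=[A_K^\top\ B^\top]$, $$\partial_{HS}\Pi_{\mathcal{P}}(x)=\{J_K\in\mathbb{R}^{n\times n}\mid K\in\mathcal{E}(x),\ J_K=I_n-H_K(H_K^\top H_K)^{-1}H_K^\top\}.$$ B-subdifferential: $\partial_B\Pi_{\mathcal{P}}(x)$ is the set of all matrices $J\in\mathbb{R}^{n\times n}$ for which there is a sequence $x^k\to x$ such that $\Pi_{\mathcal{P}}$ is (Fréchet) differentiable at every $x^k$ and $\Pi_{\mathcal{P}}'(x^k)\to J$. *)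

(* Defs.v *)
From HB Require Import structures.
From mathcomp Require Import all_boot all_order all_algebra.
From mathcomp Require Import all_classical all_reals all_analysis.

Set Implicit Arguments.
Unset Strict Implicit.
Unset Printing Implicit Defensive.

Import Order.TTheory GRing.Theory Num.Theory.
Import numFieldNormedType.Exports.

Local Open Scope classical_set_scope.
Local Open Scope ring_scope.

(* Vectors of R^n are column vectors 'cV[R]_n.  The library norm on matrices
   is the max norm; it is used only for convergence and differentiability,
   where all norms on a finite-dimensional space agree.  The projection below
   uses the Euclidean norm. *)

Definition sqnorm2 (R : realType) (n : nat) (v : 'cV[R]_n) : R :=
  \sum_(i < n) v i 0 ^+ 2.

(* [get] returns an arbitrary point when there is no minimizer. *)
Definition euclid_proj (R : realType) (n : nat) (P : set 'cV[R]_n)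
    (x : 'cV[R]_n) : 'cV[R]_n :=
  get [set y | P y /\
    forall z, P z -> 2^-1 * sqnorm2 (y - x) <= 2^-1 * sqnorm2 (z - x)].

(* The matrix of the differential acting on column vectors; the library's
   ['J f x] is for row vectors.  Meaningful when f is differentiable at x. *)
Definition cjacobian (R : realType) (n p : nat) (f : 'cV[R]_n -> 'cV[R]_p)
    (x : 'cV[R]_n) : 'M[R]_(p, n) :=
  \matrix_(i, j) ('d f x (delta_mx j 0 : 'cV[R]_n)) i 0.

Definition Bsubdifferential (R : realType) (n p : nat)
    (f : 'cV[R]_n -> 'cV[R]_p) (x : 'cV[R]_n) : set 'M[R]_(p, n) :=
  [set J | exists u : nat -> 'cV[R]_n,
    [/\ u @ \oo --> x,
        forall k, differentiable f (u k)
      & (fun k => cjacobian f (u k)) @ \oo --> J]].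

Definition polyhedron (R : realType) (m n l : nat) (A : 'M[R]_(m, n))
    (a : 'cV[R]_m) (B : 'M[R]_(l, n)) (b : 'cV[R]_l) : set 'cV[R]_n :=
  [set y | (forall i, (A *m y) i 0 <= a i 0) /\ B *m y = b].

Definition rowsof (R : realType) (m n : nat) (A : 'M[R]_(m, n))
    (K : {set 'I_m}) : 'M[R]_(#|K|, n) :=
  rowsub (fun i : 'I_#|K| => enum_val i) A.

Definition active_set (R : realType) (m n l : nat) (A : 'M[R]_(m, n))
    (a : 'cV[R]_m) (B : 'M[R]_(l, n)) (b : 'cV[R]_l) (x : 'cV[R]_n) :
    {set 'I_m} :=
  [set i | (A *m euclid_proj (polyhedron A a B b) x) i 0 == a i 0].

(* LICQ at the projection of x (not at x). *)
Definition LICQ (R : realType) (m n l : nat) (A : 'M[R]_(m, n))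
    (a : 'cV[R]_m) (B : 'M[R]_(l, n)) (b : 'cV[R]_l) (x : 'cV[R]_n) : Prop :=
  row_free (col_mx (rowsof A (active_set A a B b x)) B).

Definition KKT_multipliers (R : realType) (m n l : nat) (A : 'M[R]_(m, n))
    (a : 'cV[R]_m) (B : 'M[R]_(l, n)) (b : 'cV[R]_l) (x : 'cV[R]_n) :
    set ('cV[R]_m * 'cV[R]_l) :=
  let y := euclid_proj (polyhedron A a B b) x in
  [set lm | [/\ y - x + A^T *m lm.1 + B^T *m lm.2 = 0,
                forall i, (A *m y - a) i 0 <= 0,
                B *m y = b,
                forall i, 0 <= lm.1 i 0
              & lm.1^T *m (A *m y - a) = 0]].

Definition supp (R : realType) (m : nat) (lambda : 'cV[R]_m) : {set 'I_m} :=
  [set i | 0 < lambda i 0].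

Definition Hmx (R : realType) (m n l : nat) (A : 'M[R]_(m, n))
    (B : 'M[R]_(l, n)) (K : {set 'I_m}) : 'M[R]_(n, #|K| + l) :=
  row_mx (rowsof A K)^T B^T.

Definition HS_index (R : realType) (m n l : nat) (A : 'M[R]_(m, n))
    (a : 'cV[R]_m) (B : 'M[R]_(l, n)) (b : 'cV[R]_l) (x : 'cV[R]_n) :
    set {set 'I_m} :=
  [set K : {set 'I_m} | (exists lm, [/\ KKT_multipliers A a B b x lm,
                           supp lm.1 \subset K
                         & K \subset active_set A a B b x])
           /\ \rank (Hmx A B K) = (#|K| + l)%N].

Definition HS_jacobian (R : realType) (m n l : nat) (A : 'M[R]_(m, n))
    (a : 'cV[R]_m) (B : 'M[R]_(l, n)) (b : 'cV[R]_l) (x : 'cV[R]_n) :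
    set 'M[R]_n :=
  [set J | exists2 K : {set 'I_m}, HS_index A a B b x K &
    J = 1%:M - Hmx A B K *m invmx ((Hmx A B K)^T *m Hmx A B K)
                 *m (Hmx A B K)^T].

(* Main.v *)
Require Import Defs.
From mathcomp Require Import all_boot all_order all_algebra.
From mathcomp Require Import all_classical all_reals all_analysis.
From mathcomp Require Import ring lra.

Set Implicit Arguments.
Unset Strict Implicit.
Unset Printing Implicit Defensive.

Import Order.TTheory GRing.Theory Num.Def Num.Theory.
Import numFieldNormedType.Exports.

Local Open Scope classical_set_scope.
Local Open Scope ring_scope.

(** Write [p] for the projection, [I u] for the active set at [p u], and [J_K]
    for the orthogonal projection onto the tangent space
    [{h | A_K h = 0, B h = 0}]; the HS-Jacobian consists of matrices [J_K].

    The link with derivatives is that, where the active rows are independent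
    together with [B], differentiability of [p] at [u] alone determines the
    derivative.  The optimality conditions split [u - p u] as a nonnegative
    combination of active rows plus a combination of rows of [B].  Adding to [u]
    another vector of this form adds up the multipliers without moving the
    projection, so the derivative kills such vectors and, by linearity, the
    whole normal space; moving [u] by a small tangent vector keeps the
    multipliers and moves the projection by the same vector.  A linear map that
    kills the normal space and fixes the tangent space is [J_K] with [K = I u] ([cjacobian_proj]).

    Inclusion of the B-subdifferential in the HS-Jacobian.  By continuity of
    [p], active sets near [x] are contained in [I x], so independence is
    inherited and the multipliers are a fixed linear function of [u - p u]
    ([multiplier_readout]).  Hence multipliers positive at [x] remain positive,
    which puts their indices in [I u]: near [x], each [I u] is one of the sets
    indexing the HS-Jacobian at [x] ([active_set_HS_index_near]).  The
    derivatives near [x] therefore all lie in the HS-Jacobian, which is finite,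
    hence closed, and contains their limits.

    Converse inclusion.  Given an index set [K] with multipliers supported in
    [K] and [K] inside [I x], independence provides a direction [d] tangent to
    the rows in [K] and to [B], and strictly decreasing along the other active
    rows.  At the points [x + t (d + sum of the rows in K)], [t > 0] small, the
    active set is exactly [K] and all multipliers on [K] are positive, so [p] is
    affine nearby with linear part [J_K] ([proj_near_affine],
    [HS_index_approx]).

    Independence also gives the optimality conditions without a theorem of the
    alternative: the residual [u - p u] pairs nonpositively with every feasible
    direction, and feasible directions prescribing arbitrary nonpositive values
    on the active rows exist ([kkt_necessary]). *)

(** * The Euclidean inner product *)

Definition dot (R : realType) (n : nat) (u v : 'cV[R]_n) : R :=
  (u^T *m v) 0 0.

Section Dot.
Context {R : realType} {n : nat}.
Implicit Types (u v w : 'cV[R]_n) (t : R).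

Lemma dotE u v : dot u v = \sum_i u i 0 * v i 0.
Proof. by rewrite /dot mxE; apply: eq_bigr => i _; rewrite mxE. Qed.

Lemma dotC u v : dot u v = dot v u.
Proof. by rewrite !dotE; apply: eq_bigr => i _; rewrite mulrC. Qed.

Lemma dotDr u v w : dot u (v + w) = dot u v + dot u w.
Proof. by rewrite /dot mulmxDr mxE. Qed.

Lemma dotZr t u v : dot u (t *: v) = t * dot u v.
Proof. by rewrite /dot -scalemxAr mxE. Qed.

Lemma dotNr u v : dot u (- v) = - dot u v.
Proof. by rewrite /dot mulmxN mxE. Qed.

Lemma dotBr u v w : dot u (v - w) = dot u v - dot u w.
Proof. by rewrite dotDr dotNr. Qed.

Lemma dotDl u v w : dot (u + v) w = dot u w + dot v w.
Proof. by rewrite dotC dotDr !(dotC w). Qed.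

Lemma dotBl u v w : dot (u - v) w = dot u w - dot v w.
Proof. by rewrite dotC dotBr !(dotC w). Qed.

Lemma dotNl u v : dot (- u) v = - dot u v.
Proof. by rewrite dotC dotNr dotC. Qed.

Lemma dotZl t u v : dot (t *: u) v = t * dot u v.
Proof. by rewrite dotC dotZr dotC. Qed.

Lemma dot0r u : dot u 0 = 0.
Proof. by rewrite /dot mulmx0 mxE. Qed.

Lemma sqnorm2E v : sqnorm2 v = dot v v.
Proof. by rewrite dotE; apply: eq_bigr => i _; rewrite expr2. Qed.

Lemma dot_ge0 v : 0 <= dot v v.
Proof. by rewrite dotE sumr_ge0 // => i _; rewrite -expr2 sqr_ge0. Qed.

Lemma dot_entry_le v i : v i 0 ^+ 2 <= dot v v.
Proof.
rewrite dotE (bigD1 i) //= expr2 lerDl sumr_ge0 // => j _.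
by rewrite -expr2 sqr_ge0.
Qed.

Lemma dot_le0_eq0 v : dot v v <= 0 -> v = 0.
Proof.
move=> v0; apply/colP => i; rewrite mxE; apply/eqP.
by rewrite -(sqrf_eq0 (v i 0)) eq_le sqr_ge0 (le_trans (dot_entry_le v i)).
Qed.

End Dot.

Lemma dot_mulmx (R : realType) (p n : nat) (M : 'M[R]_(p, n)) u v :
  dot (M^T *m u) v = dot u (M *m v).
Proof. by rewrite /dot trmx_mul trmxK mulmxA. Qed.

(** A vector killed by the Gram matrix satisfies [|H v|^2 = 0]. *)
Lemma gram_unit (R : realType) (n k : nat) (H : 'M[R]_(n, k)) :
  \rank H = k -> H^T *m H \in unitmx.
Proof.
move=> rH; rewrite -row_free_unit -kermx_eq0; apply/eqP/row_matrixP => i.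
rewrite row0; set r := row i _.
have r0 : r *m (H^T *m H) = 0.
  by apply/sub_kermxP; rewrite row_sub.
have Hr : H *m r^T = 0.
  apply: dot_le0_eq0; rewrite /dot trmx_mul trmxK mulmxA -(mulmxA r) r0 mul0mx.
  by rewrite mxE.
have fH : row_free H^T by rewrite /row_free mxrank_tr rH.
apply: (row_free_inj fH); rewrite mul0mx -[r]trmxK -trmx_mul.
by rewrite Hr trmx0.
Qed.

(** * Rows indexed by a set, and vectors supported on it *)

Section Selection.
Context {R : realType} {m : nat}.
Implicit Types (K : {set 'I_m}).

Lemma rowsof_mul n p (A : 'M[R]_(m, n)) (D : 'M[R]_(n, p)) K :
  rowsof A K *m D = rowsof (A *m D) K.
Proof. by rewrite /rowsof mul_rowsub_mx. Qed.

(** Extension by zero of a vector indexed by [K]; with it, combinations of the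
    rows in [K] become combinations [A^T *m la] with [la] supported on [K], so
    different sets [K] can be compared without reindexing. *)
Definition extend K (w : 'cV[R]_#|K|) : 'cV[R]_m := (rowsof 1%:M K)^T *m w.

Definition supported K (w : 'cV[R]_m) := forall i, i \notin K -> w i 0 = 0.

Lemma supported_subset K K' w : K \subset K' -> supported K w -> supported K' w.
Proof.
by move=> /fintype.subsetP s h i iK; apply: h; apply: contra iK => /s.
Qed.

Lemma extend_supported K (w : 'cV[R]_#|K|) : supported K (extend w).
Proof.
move=> i iK; rewrite /extend mxE big1 // => k _; rewrite !mxE.
case: eqP => [ki|_]; last by rewrite mul0r.
by move: iK; rewrite -ki enum_valP.
Qed.

Lemma extend_enum_val K (w : 'cV[R]_#|K|) k : extend w (enum_val k) 0 = w k 0.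
Proof.
rewrite /extend mxE (bigD1 k) //= !mxE eqxx mul1r big1 ?addr0 // => j jk.
by rewrite !mxE (inj_eq enum_val_inj) (negPf jk) mul0r.
Qed.

Lemma extend_rowsof K (w : 'cV[R]_m) : supported K w -> extend (rowsof w K) = w.
Proof.
move=> sw; apply/colP => i; case: (boolP (i \in K)) => iK; last first.
  by rewrite sw // extend_supported.
by rewrite -(enum_rankK_in iK iK) extend_enum_val mxE.
Qed.

Lemma trmx_rowsof_mul n (A : 'M[R]_(m, n)) K (w : 'cV[R]_#|K|) :
  (rowsof A K)^T *m w = A^T *m extend w.
Proof. by rewrite /extend mulmxA -trmx_mul rowsof_mul mul1mx. Qed.

End Selection.

(** * Independent rows and the orthogonal projection onto their kernel *)

Section Independence.
Context {R : realType} {m n l : nat}.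
Variables (A : 'M[R]_(m, n)) (B : 'M[R]_(l, n)).
Implicit Types (K : {set 'I_m}).

Definition independent_rows K := row_free (col_mx (rowsof A K) B).

Lemma Hmx_tr K : (Hmx A B K)^T = col_mx (rowsof A K) B.
Proof. by rewrite /Hmx tr_row_mx !trmxK. Qed.

Lemma Hmx_rank K : \rank (Hmx A B K) = (#|K| + l)%N <-> independent_rows K.
Proof.
rewrite /independent_rows /row_free -Hmx_tr mxrank_tr.
by split => [->|/eqP].
Qed.

Lemma Hmx_mul K (w : 'cV[R]_(#|K| + l)) :
  Hmx A B K *m w = A^T *m extend (usubmx w) + B^T *m dsubmx w.
Proof. by rewrite -{1}[w]vsubmxK /Hmx mul_row_col trmx_rowsof_mul. Qed.

Lemma row_combination K (la : 'cV[R]_m) (mu : 'cV[R]_l) : supported K la ->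
  A^T *m la + B^T *m mu = Hmx A B K *m col_mx (rowsof la K) mu.
Proof.
by move=> sla; rewrite Hmx_mul col_mxKu col_mxKd extend_rowsof.
Qed.

(** Independence makes multipliers unique; the point here is that they are even
    a fixed continuous function of the combination, uniformly in its support. *)
Lemma multiplier_readout K : independent_rows K ->
  exists L : 'M[R]_(m, n), forall (la : 'cV[R]_m) (mu : 'cV[R]_l),
    supported K la -> L *m (A^T *m la + B^T *m mu) = la.
Proof.
case/row_freeP => N; rewrite -Hmx_tr => HN.
exists ((rowsof 1%:M K)^T *m usubmx N^T) => la mu sla.
rewrite (row_combination _ sla).
have NH : N^T *m Hmx A B K = 1%:M.
  by rewrite -[LHS]trmxK trmx_mul trmxK HN trmx1.
rewrite -mulmxA mul_usub_mx (mulmxA N^T) NH mul1mx col_mxKu.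
exact: extend_rowsof.
Qed.

Lemma independent_rowsP K :
  independent_rows K <-> (forall (la : 'cV[R]_m) (mu : 'cV[R]_l),
    supported K la -> A^T *m la + B^T *m mu = 0 -> la = 0 /\ mu = 0).
Proof.
split=> [iK la mu sla|h].
  rewrite (row_combination _ sla) => H0.
  have : col_mx (rowsof la K) mu = 0.
    apply: trmx_inj; apply: (row_free_inj iK).
    by rewrite trmx0 mul0mx -Hmx_tr -trmx_mul H0 trmx0.
  rewrite -col_mx0 => /eq_col_mx[l0 ->]; split => //.
  by rewrite -(extend_rowsof sla) l0 /extend mulmx0.
rewrite /independent_rows -kermx_eq0; apply/eqP/row_matrixP => i.
rewrite row0; set r := row i _.
have : Hmx A B K *m r^T = 0.
  apply: trmx_inj; rewrite trmx_mul trmxK Hmx_tr trmx0.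
  by apply/sub_kermxP; rewrite row_sub.
rewrite Hmx_mul => /(h _ _ (extend_supported _))[u0 d0].
apply: trmx_inj; rewrite trmx0 -[LHS]vsubmxK d0.
suff -> : usubmx r^T = 0 by rewrite col_mx0.
by apply/colP => k; rewrite -extend_enum_val u0 !mxE.
Qed.

Lemma independent_rows_subset K K' :
  K \subset K' -> independent_rows K' -> independent_rows K.
Proof.
move=> KK' /independent_rowsP iK'; apply/independent_rowsP => la mu sla.
exact/iK'/(supported_subset KK').
Qed.

(** Dual form of independence: the values of a direction on the rows of [A] in
    [K] can be prescribed inside the kernel of [B]. *)
Lemma independent_rows_surj K (c : 'cV[R]_m) : independent_rows K ->
  exists d : 'cV[R]_n,
    (forall i, i \in K -> (A *m d) i 0 = c i 0) /\ B *m d = 0.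
Proof.
case/row_freeP => N HN; exists (N *m col_mx (rowsof c K) 0).
have : col_mx (rowsof A K) B *m (N *m col_mx (rowsof c K) 0) =
  col_mx (rowsof c K) 0 by rewrite mulmxA HN mul1mx.
rewrite mul_col_mx => /eq_col_mx[e1 e2]; split => // i iK.
have := congr1 (fun M : 'cV_#|K| => M (enum_rank_in iK i) 0) e1.
by rewrite rowsof_mul !mxE enum_rankK_in // => <-.
Qed.

Definition tangent_proj K : 'M[R]_n :=
  1%:M - Hmx A B K *m invmx ((Hmx A B K)^T *m Hmx A B K) *m (Hmx A B K)^T.

Section TangentProjection.
Variable K : {set 'I_m}.
Hypothesis indK : independent_rows K.

Lemma Hmx_tangent_proj : (Hmx A B K)^T *m tangent_proj K = 0.
Proof.
rewrite /tangent_proj mulmxBr mulmx1 !mulmxA mulmxV ?mul1mx ?subrr //.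
exact/gram_unit/Hmx_rank.
Qed.

Lemma tangent_proj_blocks :
  rowsof A K *m tangent_proj K = 0 /\ B *m tangent_proj K = 0.
Proof.
by apply: eq_col_mx; rewrite -mul_col_mx -Hmx_tr Hmx_tangent_proj col_mx0.
Qed.

Lemma tangent_proj_active (h : 'cV[R]_n) i :
  i \in K -> (A *m (tangent_proj K *m h)) i 0 = 0.
Proof.
move=> iK; have [e _] := tangent_proj_blocks.
have /(congr1 (fun M : 'cV[R]_#|K| => M (enum_rank_in iK i) 0)) :
  rowsof A K *m (tangent_proj K *m h) = 0 by rewrite mulmxA e mul0mx.
by rewrite rowsof_mul !mxE enum_rankK_in.
Qed.

Lemma tangent_proj_eqs (h : 'cV[R]_n) : B *m (tangent_proj K *m h) = 0.
Proof.
by have [_ e] := tangent_proj_blocks; rewrite mulmxA e mul0mx.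
Qed.

(** [h - J_K h] lies in the span of the rows, with coefficients depending
    linearly on [h]; hence they are small when [h] is small. *)
Lemma tangent_proj_residual : exists (S : 'M[R]_(m, n)) (T : 'M[R]_(l, n)),
  forall h : 'cV[R]_n, supported K (S *m h) /\
    h - tangent_proj K *m h = A^T *m (S *m h) + B^T *m (T *m h).
Proof.
pose W := invmx ((Hmx A B K)^T *m Hmx A B K) *m (Hmx A B K)^T.
exists ((rowsof 1%:M K)^T *m usubmx W), (dsubmx W) => h; split.
  by rewrite -mulmxA -/(extend _); exact: extend_supported.
rewrite /tangent_proj mulmxBl mul1mx opprB addrC subrK.
rewrite -(mulmxA (Hmx A B K)) -/W -[LHS]mulmxA Hmx_mul.
by rewrite -mul_usub_mx -mul_dsub_mx /extend !mulmxA.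
Qed.

(** Every [h] is the sum of its normal part [h - J_K h] and its tangent part
    [J_K h], so the action on these two spaces determines [D]. *)
Lemma tangent_proj_unique (D : 'M[R]_n) :
  (forall la mu, supported K la -> D *m (A^T *m la + B^T *m mu) = 0) ->
  (forall h : 'cV[R]_n, (forall i, i \in K -> (A *m h) i 0 = 0) -> B *m h = 0 ->
     D *m h = h) ->
  D = tangent_proj K.
Proof.
move=> Dnormal Dtangent; have [S [T ST]] := tangent_proj_residual.
suff DE (h : 'cV[R]_n) : D *m h = tangent_proj K *m h.
  by apply/row_matrixP => i; apply/rowP => j;
     have /colP/(_ i) := DE (delta_mx j 0); rewrite -!colE !mxE.
have [sh eh] := ST h.
rewrite -[in LHS](subrK (tangent_proj K *m h) h) mulmxDr eh Dnormal // add0r.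
rewrite Dtangent //; last exact: tangent_proj_eqs.
by move=> i; exact: tangent_proj_active.
Qed.

End TangentProjection.

End Independence.

(** * Entrywise convergence of matrices *)

Section MatrixTopology.
Context {R : realType}.

Lemma mx_entry_le_norm m n (M : 'M[R]_(m, n)) i j : `|M i j| <= `|M|.
Proof.
rewrite [leRHS]/normr /= mx_normrE.
exact: (le_bigmax _ (fun ij : 'I_m * 'I_n => `|M ij.1 ij.2|) (i, j)).
Qed.

Lemma cvg_mx_entries T (F : set_system T) {FF : Filter F} m n
    (f : T -> 'M[R]_(m, n)) (M : 'M[R]_(m, n)) :
  (forall i j, f t i j @[t --> F] --> M i j) -> f @ F --> M.
Proof.
move=> fM; apply/cvgrPdist_lt => e e0.
have : \forall t \near F, forall i j, `|M i j - f t i j| < e.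
  apply: filter_forall => i; apply: filter_forall => j.
  by have /cvgrPdist_lt/(_ _ e0) := fM i j.
apply: filterS => t Hij; rewrite [ltLHS]/normr /= mx_normrE.
by apply/bigmax_ltP; split => // -[i j] _; rewrite !mxE.
Qed.

Lemma cvg_entry T (F : set_system T) {FF : Filter F} m n
    (f : T -> 'M[R]_(m, n)) (M : 'M[R]_(m, n)) i j :
  f @ F --> M -> f t i j @[t --> F] --> M i j.
Proof.
move=> fM.
apply: (@continuous_cvg _ _ _ F FF f (fun N : 'M[R]_(m, n) => N i j) M _ fM).
exact: coord_continuous.
Qed.

Lemma cvg_mulmx T (F : set_system T) {FF : Filter F} m n p (M : 'M[R]_(m, n))
    (f : T -> 'M[R]_(n, p)) (N : 'M[R]_(n, p)) :
  f @ F --> N -> M *m f t @[t --> F] --> M *m N.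
Proof.
move=> fN; apply: cvg_mx_entries => i j.
under eq_fun do rewrite mxE; rewrite mxE.
apply: cvg_big => [|k _]; first exact: add_continuous.
by apply: cvgM; [exact: cvg_cst|exact: cvg_entry].
Qed.

Lemma cvg_dot T (F : set_system T) {FF : Filter F} n
    (f g : T -> 'cV[R]_n) (u v : 'cV[R]_n) :
  f @ F --> u -> g @ F --> v -> dot (f t) (g t) @[t --> F] --> dot u v.
Proof.
move=> fu gv; under eq_fun do rewrite dotE; rewrite dotE.
apply: cvg_big => [|k _]; first exact: add_continuous.
by apply: cvgM; exact: cvg_entry.
Qed.

Lemma cvg_trmx T (F : set_system T) {FF : Filter F} m n
    (f : T -> 'M[R]_(m, n)) (N : 'M[R]_(m, n)) :
  f @ F --> N -> (f t)^T @[t --> F] --> N^T.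
Proof.
move=> fN; apply: cvg_mx_entries => i j.
by under eq_fun do rewrite mxE; rewrite mxE; exact: cvg_entry.
Qed.

Lemma dot_le_norm n (v : 'cV[R]_n) : dot v v <= n%:R * `|v| ^+ 2.
Proof.
have -> : n%:R * `|v| ^+ 2 = \sum_(i < n) `|v| ^+ 2.
  by rewrite sumr_const card_ord mulr_natl.
rewrite dotE; apply: ler_sum => i _; rewrite -expr2 -real_normK ?num_real //.
by rewrite lerXn2r ?nnegrE // mx_entry_le_norm.
Qed.

End MatrixTopology.

(** * Projection onto a nonempty closed convex set *)

Section Projection.
Context {R : realType} {n : nat}.
Variable P : set 'cV[R]_n.
Hypothesis P_closed : closed P.
Hypothesis P_nonempty : P !=set0.
Hypothesis P_segment : forall y z (t : R), P y -> P z -> 0 <= t <= 1 ->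
  P (y + t *: (z - y)).
Local Notation p := (euclid_proj P).

(** Only the points of [P] at least as close to [x] as some fixed [y0] matter,
    and they form a compact set. *)
Lemma nearest_point_exists (x : 'cV[R]_n) : exists y, P y /\
  forall z, P z -> dot (y - x) (y - x) <= dot (z - x) (z - x).
Proof.
have [y0 Py0] := P_nonempty.
(* The extreme value theorem for vectors is about rows, hence the transposes. *)
pose tr (r : 'rV[R]_n) : 'cV[R]_n := r^T.
have trc : continuous tr by move=> r; apply: (@cvg_trmx R _ (nbhs r) _ _ _ id).
pose f (r : 'rV[R]_n) : R := dot (tr r - x) (tr r - x).
have fc : continuous f.
  move=> r; have rx : tr s - x @[s --> r] --> tr r - x.
    exact: (cvgB (trc r) (cvg_cst x)).
  exact: (cvg_dot rx rx).
pose S := [set r | P (tr r)] `&` [set r : 'rV[R]_n | f r <= f y0^T].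
have Sy0 : S y0^T by split => //=; rewrite /tr trmxK.
have S_closed : closed S.
  have S1 := (continuous_closedP tr).1 trc P P_closed.
  have S2 := (continuous_closedP f).1 fc _ (@closed_le R (f y0^T)).
  exact: closedI S1 S2.
have S_bounded : bounded_set S.
  exists (`|x| + (f y0^T + 1)); split; first exact: num_real.
  move=> M MM r [_ /= fr]; apply: le_trans (ltW MM).
  have f0 : 0 <= f y0^T by exact: dot_ge0.
  have -> : `|r| = `|r^T|.
    apply/eqP; rewrite eq_le [`|r|]/normr [`|r^T|]/normr /= !mx_normrE.
    apply/andP; split; apply/bigmax_leP; split => [|[i j] _ /=];
      try by apply: bigmax_ge_id.
      have := le_bigmax 0 (fun ij : 'I_n * 'I_1 => `|r^T ij.1 ij.2|) (j, i).
      by rewrite /= mxE.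
    have := le_bigmax 0 (fun ij : 'I_1 * 'I_n => `|r ij.1 ij.2|) (j, i).
    by rewrite /= mxE.
  rewrite -[r^T](subrK x) addrC; apply: (le_trans (ler_normD _ _)).
  rewrite lerD2l [leLHS]/normr /= mx_normrE.
  apply/bigmax_leP; split; first by rewrite addr_ge0.
  move=> [i j] _ /=; rewrite [j]ord1 -(ler_pXn2r (n := 2)) ?nnegrE ?addr_ge0 //.
  rewrite real_normK ?num_real //; apply: (le_trans (dot_entry_le _ _)).
  by apply: (le_trans fr); nra.
have Sne : S !=set0 by exists y0^T.
have fw : {within S, continuous f} by apply: continuous_subspaceT.
have [c cS cmin] :=
  EVT_min_rV Sne (bounded_closed_compact S_bounded S_closed) fw.
move: cS; rewrite inE => -[Pc fc0]; exists c^T; split => // z Pz.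
have fz : f z^T = dot (z - x) (z - x) by rewrite /f /tr trmxK.
rewrite -fz; have [le_f|/ltW ge_f] := leP (f z^T) (f y0^T).
  by apply: cmin; rewrite inE; split => //=; rewrite /tr trmxK.
exact: (le_trans fc0).
Qed.

Lemma euclid_proj_nearest x : P (p x) /\
  forall z, P z -> dot (p x - x) (p x - x) <= dot (z - x) (z - x).
Proof.
have [y [Py ymin]] := nearest_point_exists x.
have [|Pz zmin] := @getI _ [set y | P y /\ forall z, P z ->
    2^-1 * sqnorm2 (y - x) <= 2^-1 * sqnorm2 (z - x)] y.
  split => // w Pw; rewrite !sqnorm2E ler_pM2l ?invr_gt0 //.
  exact: ymin.
split=> // w Pw; move: (zmin w Pw); rewrite !sqnorm2E.
by rewrite ler_pM2l // invr_gt0.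
Qed.

Lemma euclid_proj_in x : P (p x).
Proof. by have [] := euclid_proj_nearest x. Qed.

(** Moving from [p x] towards [z] by a step [t] changes the squared distance by
    [t^2 |z - p x|^2 - 2 t g], with [g] the inner product in the statement;
    minimality for small [t] forces [g <= 0]. *)
Lemma euclid_proj_variational x z : P z -> dot (x - p x) (z - p x) <= 0.
Proof.
move=> Pz; have [Pp pmin] := euclid_proj_nearest x.
move: (z - p x) (fun t => P_segment (t := t) Pp Pz) => v Pv.
have quad t : 0 <= t <= 1 -> 2 * t * dot (x - p x) v <= t ^+ 2 * dot v v.
  move=> t01; have := pmin _ (Pv t t01).
  have -> : p x + t *: v - x = t *: v - (x - p x).
    by rewrite opprB addrA (addrC (p x)).
  rewrite -[p x - x]opprB; move: (x - p x) => g.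
  rewrite !(dotBl, dotBr, dotZr, dotNr, dotNl, dotZl) (dotC v g); lra.
have q0 := dot_ge0 v.
rewrite leNgt; apply/negP => g0.
move: (dot v v) (dot (x - p x) v) q0 g0 quad => q g q0 g0 quad.
(* The quadratic is least at t = g / q; adding g to the denominator keeps t
   at most 1, allows q = 0, and still gives a negative value. *)
have qg : 0 < q + g by lra.
have t0 : 0 < g / (q + g) by rewrite divr_gt0.
have /quad : 0 <= g / (q + g) <= 1.
  by rewrite ltW //= ler_pdivrMr // mul1r lerDr.
have : g / (q + g) * (q + g) = g by rewrite divfK // gt_eqF.
move: (g / (q + g)) t0 => t t0 tqg le_t.
have tg : 0 < t * g by rewrite mulr_gt0.
have : t ^+ 2 * q = t * g - t * (t * g).
  have -> : t ^+ 2 * q = t * (t * (q + g)) - t * (t * g) by ring.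
  by rewrite tqg.
have : 0 < t * (t * g) by rewrite mulr_gt0.
lra.
Qed.

(** The inequality for [y] tested at [p x], plus the one for [p x] tested at
    [y], bounds [|p x - y|^2] by zero. *)
Lemma euclid_proj_unique x y : P y ->
  (forall z, P z -> dot (x - y) (z - y) <= 0) -> p x = y.
Proof.
move=> Py yvar; have := yvar _ (euclid_proj_in x).
have := euclid_proj_variational x Py => h1 h2.
apply/subr0_eq/dot_le0_eq0.
have -> : dot (p x - y) (p x - y) =
    dot (x - y) (p x - y) + dot (x - p x) (y - p x).
  have -> : x - p x = (x - y) - (p x - y) by rewrite opprB addrA subrK.
  rewrite -[y - p x]opprB; move: (x - y) (p x - y) => e f.
  by rewrite !(dotBl, dotBr, dotNr); ring.
by rewrite -[leRHS]addr0 lerD.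
Qed.

(** By the variational inequalities the residual difference
    [(x - p x) - (y - p y)] pairs nonnegatively with [p x - p y], and the sum of
    these two vectors is [x - y]. *)
Lemma euclid_proj_nonexpansive x y :
  dot (p x - p y) (p x - p y) <= dot (x - y) (x - y).
Proof.
have h1 := euclid_proj_variational x (euclid_proj_in y).
have h2 := euclid_proj_variational y (euclid_proj_in x).
have -> : x - y = (x - p x) - (y - p y) + (p x - p y).
  by apply/colP => i; rewrite !mxE; ring.
move: h1 h2; rewrite -[p y - p x]opprB.
move: (x - p x) (y - p y) (p x - p y) => gx gy d.
have := dot_ge0 (gx - gy).
rewrite !(dotBl, dotBr, dotDl, dotDr, dotNr) (dotC d gx) (dotC d gy); lra.
Qed.

Lemma euclid_proj_cvg (x : 'cV[R]_n) : p y @[y --> x] --> p x.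
Proof.
apply/(@cvgrPdist_lt _ _ _ (nbhs x)) => e e0.
(* In max norms the projection has Lipschitz constant at most sqrt n, which is
   replaced by n + 1, positive for every n. *)
have n0 : 0 < n.+1%:R :> R by rewrite ltr0n.
have e'0 : 0 < e / n.+1%:R by rewrite divr_gt0.
have := nbhsx_ballx x _ e'0; rewrite -ball_normE.
apply: filterS => y /=; rewrite ltr_pdivlMr // => xy.
rewrite [ltLHS]/normr /= mx_normrE; apply/bigmax_ltP; split => // -[i j] _ /=.
rewrite [j]ord1; apply: le_lt_trans xy.
rewrite -(ler_pXn2r (n := 2)) ?nnegrE ?mulr_ge0 ?normr_ge0 //.
rewrite real_normK ?num_real //; apply: (le_trans (dot_entry_le _ _)).
apply: (le_trans (euclid_proj_nonexpansive _ _)).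
apply: (le_trans (dot_le_norm _)); rewrite exprMn mulrC ler_wpM2l ?sqr_ge0 //.
by rewrite -natrX ler_nat (leq_trans (leqnSn n)) // leq_pmulr.
Qed.

End Projection.

(** * Differentials of locally affine maps, and one-sided derivatives *)

Lemma diff_locally_linear (R : realType) (V W : normedModType R) (f : V -> W)
    (df : {linear V -> W}) u :
  continuous df -> (\forall v \near u, f v = f u + df (v - u)) ->
  differentiable f u /\ 'd f u = df :> (V -> W).
Proof.
move=> dfc fu.
have fo : f \o shift u = cst (f u) + df +o_ 0 id.
  apply/eqaddoP => e e0; move/nbhs0P: fu; apply: filterS => h fh.
  rewrite [X in `|X|](_ : _ = 0); first by rewrite normr0 mulr_ge0 // ltW.
  by rewrite !fctE /= (addrC h) fh (addrC u) addrK subrr.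
have dfE := diff_unique dfc fo.
by split => //; apply/diff_locallyP; rewrite dfE.
Qed.

Section Differentials.
Context {R : realType} {n p : nat}.

Lemma cvg_mulmx_entry m (M : 'M[R]_(m, n)) (v : 'cV[R]_n) i :
  (M *m w) i 0 @[w --> v] --> (M *m v) i 0.
Proof.
apply: (@cvg_entry R _ (nbhs v)); apply: (@cvg_mulmx R _ (nbhs v) _ _ _ _ M id).
exact: cvg_id.
Qed.

Lemma near_mulmx_small m (M : 'M[R]_(m, n)) (u : 'cV[R]_n) i (e : R) :
  0 < e -> \forall v \near u, `|(M *m (v - u)) i 0| < e.
Proof.
move=> e0; have /(@cvgrPdist_lt _ _ _ (nbhs u))/(_ e e0) :=
  @cvg_mulmx_entry m M u i.
by apply: filterS => v; rewrite distrC mulmxBr [X in _ -> `|X| < e]mxE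
  [X in _ -> `|_ + X| < e]mxE.
Qed.

Lemma mulmx_cV_continuous (J : 'M[R]_(p, n)) :
  continuous (mulmx J : 'cV[R]_n -> 'cV[R]_p).
Proof.
by move=> v; apply: (@cvg_mulmx R _ (nbhs v) _ _ _ _ J id); exact: cvg_id.
Qed.

Lemma cjacobian_mul (f : 'cV[R]_n -> 'cV[R]_p) u h :
  cjacobian f u *m h = 'd f u h.
Proof.
have -> : h = \sum_j h j 0 *: delta_mx j 0.
  rewrite {1}[h]matrix_sum_delta; apply: eq_bigr => i _.
  by rewrite big_ord1.
rewrite mulmx_sumr linear_sum; apply: eq_bigr => j _.
rewrite -scalemxAr linearZ /=; congr (_ *: _).
by rewrite -colE; apply/colP => i; rewrite !mxE.
Qed.

(** One-sided rays suffice to compute a differential known to exist.  This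
    matters because feasibility and signs of multipliers only persist for
    [t > 0]. *)
Lemma diff_right (f : 'cV[R]_n -> 'cV[R]_p) u h v : differentiable f u ->
  (\forall t \near 0^'+, f (u + t *: h) = f u + t *: v) -> 'd f u h = v.
Proof.
move=> df fv; rewrite -deriveE // /derive.
rewrite cvg_at_rightE; last exact: diff_derivable.
apply: cvg_lim => //; apply: cvg_near_cst; near=> t.
have t0 : 0 < t by near: t; exact: nbhs_right_gt.
rewrite /= (addrC (t *: h)) (near fv t) // (addrC (f u)) addrK scalerA.
by rewrite mulVf ?scale1r // gt_eqF.
Unshelve. all: by end_near.
Qed.

Lemma locally_affine_diff (f : 'cV[R]_n -> 'cV[R]_p) (u : 'cV[R]_n)
    (c : 'cV[R]_p) (J : 'M[R]_(p, n)) :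
  (\forall v \near u, f v = c + J *m (v - u)) ->
  differentiable f u /\ cjacobian f u = J.
Proof.
move=> fJ; pose df : {linear 'cV[R]_n -> 'cV[R]_p} := mulmx J.
have fu : f u = c by rewrite (nbhs_singleton fJ) subrr mulmx0 addr0.
have [|fd dfE] := @diff_locally_linear _ _ _ f df u (@mulmx_cV_continuous J).
  by apply: filterS fJ => v; rewrite fu.
by split => //; apply/matrixP => i j; rewrite mxE dfE /= -colE mxE.
Qed.

End Differentials.

(** * Optimality conditions and derivatives for a polyhedron *)

Section Polyhedron.
Context {R : realType} {m n l : nat}.
Variables (A : 'M[R]_(m, n)) (a : 'cV[R]_m) (B : 'M[R]_(l, n)) (b : 'cV[R]_l).
Local Notation P := (polyhedron A a B b).
Local Notation p := (euclid_proj P).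
Local Notation I := (active_set A a B b).
Hypothesis P_nonempty : P !=set0.

Lemma polyhedron_closed : closed P.
Proof.
have cE q (M : 'M[R]_(q, n)) i : continuous (fun y : 'cV[R]_n => (M *m y) i 0).
  by move=> v; exact: cvg_mulmx_entry.
have -> : P =
  (\bigcap_(i in [set: 'I_m])
     (fun y => (A *m y) i 0) @^-1` [set r | r <= a i 0]) `&`
  \bigcap_(i in [set: 'I_l])
     (fun y => (B *m y) i 0) @^-1` [set r | r = b i 0].
  rewrite predeqE => y; split=> [[yA yB]|[yA yB]]; split.
  - by move=> i _; exact: yA.
  - by move=> i _ /=; rewrite yB.
  - by move=> i; exact: yA.
  - by apply/colP => i; exact: yB.
apply: closedI; apply: closed_bigI => i _.
- exact: (continuous_closedP _).1 (cE _ _ _) _ (@closed_le _ _).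
- exact: (continuous_closedP _).1 (cE _ _ _) _ (@closed_eq _ _).
Qed.

Lemma polyhedron_segment y z (t : R) :
  P y -> P z -> 0 <= t <= 1 -> P (y + t *: (z - y)).
Proof.
move=> [yA yB] [zA zB] /andP[t0 t1]; split; last first.
  by rewrite mulmxDr -scalemxAr mulmxBr yB zB subrr scaler0 addr0.
move=> i; rewrite mulmxDr -scalemxAr mulmxBr !mxE -![\sum_j _]/(_).
have := yA i; have := zA i; rewrite !mxE; nra.
Qed.

Let proj_in x : P (p x).
Proof. exact: (euclid_proj_in polyhedron_closed P_nonempty). Qed.

Let proj_cvg (x : 'cV[R]_n) : p y @[y --> x] --> p x.
Proof.
exact: (euclid_proj_cvg polyhedron_closed P_nonempty polyhedron_segment).
Qed.

Lemma active_setP x i : reflect ((A *m p x) i 0 = a i 0) (i \in I x).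
Proof. by rewrite inE; exact: eqP. Qed.

Lemma active_setPn x i : i \notin I x -> (A *m p x) i 0 < a i 0.
Proof. by rewrite inE lt_neqAle => ->; have [/(_ i)] := proj_in x. Qed.

Lemma ray_entry (y d : 'cV[R]_n) (t : R) i :
  (A *m (y + t *: d)) i 0 = (A *m y) i 0 + t * (A *m d) i 0.
Proof. by rewrite mulmxDr -scalemxAr !mxE. Qed.

Lemma slack_direction (y d : 'cV[R]_n) i : (A *m y) i 0 < a i 0 ->
  \forall t \near 0^'+, (A *m (y + t *: d)) i 0 < a i 0.
Proof.
rewrite -subr_gt0; set s := a i 0 - _ => s0; set c := (A *m d) i 0.
have c1 : 0 < `|c| + 1 by rewrite ltr_wpDl.
have sc0 : 0 < s / (`|c| + 1) by rewrite divr_gt0.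
near=> t; have t0 : 0 < t by [].
have : t < s / (`|c| + 1) by near: t; exact: nbhs_right_lt.
rewrite ray_entry -/c ltr_pdivlMr // => ts.
rewrite -ltrBrDl -/s; apply: le_lt_trans ts.
by rewrite ler_pM2l // (le_trans (ler_norm _)) // lerDl.
Unshelve. all: by end_near.
Qed.

Lemma feasible_direction y d : P y ->
  (forall i, (A *m y) i 0 = a i 0 -> (A *m d) i 0 <= 0) -> B *m d = 0 ->
  \forall t \near 0^'+, P (y + t *: d).
Proof.
move=> [yA yB] dA dB.
have : \forall t \near 0^'+, forall i, (A *m (y + t *: d)) i 0 <= a i 0.
  apply: filter_forall => i.
  have [eq_i|neq_i] := eqVneq ((A *m y) i 0) (a i 0); last first.
    have lt_i : (A *m y) i 0 < a i 0 by rewrite lt_neqAle neq_i yA.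
    by apply: filterS (slack_direction d lt_i) => t /ltW.
  near=> t; have t0 : 0 < t by [].
  by rewrite ray_entry eq_i gerDl pmulr_rle0 // dA.
apply: filterS => t tA; split => //.
by rewrite mulmxDr yB -scalemxAr dB scaler0 addr0.
Unshelve. all: by end_near.
Qed.

(** Pairing the combination with [z - y], [z] feasible, gives
    [sum_i la_i (A z - a)_i <= 0], the variational inequality characterizing
    the projection. *)
Lemma kkt_sufficient K u y la mu : P y -> supported K la ->
  (forall i, i \in K -> 0 <= la i 0 /\ (A *m y) i 0 = a i 0) ->
  u - y = A^T *m la + B^T *m mu -> p u = y.
Proof.
move=> Py sla laK uy.
apply: (euclid_proj_unique polyhedron_closed P_nonempty polyhedron_segment Py).
move=> z [zA zB]; have [yA yB] := Py.
rewrite uy dotDl !dot_mulmx [in B *m _]mulmxBr zB yB subrr dot0r addr0.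
rewrite dotE; apply: sumr_le0 => i _.
have [iK|iK] := boolP (i \in K); last by rewrite sla // mul0r.
have [la0 eq_i] := laK i iK; rewrite mulmxBr mxE [X in _ + X]mxE eq_i.
by rewrite mulr_ge0_le0 // subr_le0.
Qed.

(** The tangent part of [g = u - p u] is itself a feasible direction, so the
    variational inequality bounds its squared norm by zero and [g] is normal.
    The [i]-th coefficient is nonnegative because the direction with value [-1]
    on row [i] and [0] on the other active rows is feasible. *)
Lemma kkt_necessary u : independent_rows A B (I u) ->
  exists la mu, [/\ supported (I u) la, forall i, 0 <= la i 0 &
    u - p u = A^T *m la + B^T *m mu].
Proof.
move=> indI.
have dir d : (forall i, i \in I u -> (A *m d) i 0 <= 0) -> B *m d = 0 ->
    dot (u - p u) d <= 0.
  move=> dA dB.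
  have feas : \forall t \near 0^'+, P (p u + t *: d).
    by apply: feasible_direction => // i /active_setP; exact: dA.
  near (0 : R)^'+ => t.
  have t0 : 0 < t by near: t; exact: nbhs_right_gt.
  have Pt : P (p u + t *: d) by near: t.
  have := euclid_proj_variational polyhedron_closed P_nonempty
    polyhedron_segment u Pt.
  by rewrite addrAC subrr add0r dotZr pmulr_rle0.
have [S [T ST]] := tangent_proj_residual A B (I u).
have [] := ST (u - p u).
set g := u - p u in dir *; set Jg := tangent_proj A B (I u) *m g.
move=> sla eq_g.
have Jg0 : Jg = 0.
  have AJ i : i \in I u -> (A *m Jg) i 0 = 0 by exact: tangent_proj_active.
  have BJ : B *m Jg = 0 by exact: tangent_proj_eqs.
  apply: dot_le0_eq0; apply: le_trans (dir Jg _ BJ); last first.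
    by move=> i /AJ ->.
  rewrite -[g in leRHS](subrK Jg) eq_g !dotDl !dot_mulmx BJ dot0r addr0 lerDr.
  rewrite dotE big1 // => i _.
  by have [/AJ ->|/sla ->] := boolP (i \in I u); rewrite ?mulr0 ?mul0r.
move: eq_g; rewrite Jg0 subr0 => eq_g.
exists (S *m g), (T *m g); split=> // i.
have [iI|/sla -> //] := boolP (i \in I u).
have [d [dA dB]] := independent_rows_surj (- delta_mx i 0) indI.
have : dot g d <= 0.
  by apply: dir => // j jI; rewrite dA // !mxE oppr_le0 ler0n.
move: (S *m g) (T *m g) sla eq_g => la mu sla ->.
rewrite dotDl !dot_mulmx dB dot0r addr0 dotE (bigD1 i) //= big1 => [|j ji].
  by rewrite dA // !mxE !eqxx mulrN1 addr0 oppr_le0.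
have [jI|/sla ->] := boolP (j \in I u); last by rewrite mul0r.
by rewrite dA // !mxE (negPf ji) oppr0 mulr0.
Unshelve. all: by end_near.
Qed.

(** Along a normal direction with nonnegative coefficients the projection stays
    at [p u]; along a tangent direction [h] it moves by [t *: h].  The
    nonnegativity restriction disappears by linearity of the differential. *)
Lemma cjacobian_proj u : independent_rows A B (I u) -> differentiable p u ->
  cjacobian p u = tangent_proj A B (I u).
Proof.
move=> indI dp; have [la [mu [sla la0 eq_u]]] := kkt_necessary indI.
have atI i : i \in I u -> (A *m p u) i 0 = a i 0 by move/active_setP.
have normal_ge0 la' mu' : supported (I u) la' -> (forall i, 0 <= la' i 0) ->
    cjacobian p u *m (A^T *m la' + B^T *m mu') = 0.
  move=> sla' la'0; rewrite cjacobian_mul; apply: diff_right => //.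
  near=> t; have t0 : 0 < t by [].
  rewrite scaler0 addr0.
  apply: (@kkt_sufficient (I u) _ _ (la + t *: la') (mu + t *: mu')) => //.
  - by move=> i iI; rewrite !mxE sla // sla' // mulr0 addr0.
  - move=> i iI; split; last exact: atI.
    by rewrite !mxE addr_ge0 // mulr_ge0 // ltW.
  - rewrite addrAC eq_u !mulmxDr -!scalemxAr scalerDr.
    by rewrite addrACA.
apply: tangent_proj_unique => // [la' mu' sla'|h Ah Bh].
  (* Positive and negative parts of the coefficients. *)
  pose pos := map_mx (fun r : R => Num.max r 0) la'.
  pose neg := map_mx (fun r : R => Num.max (- r) 0) la'.
  have -> : A^T *m la' + B^T *m mu' =
      (A^T *m pos + B^T *m mu') - (A^T *m neg + B^T *m 0).
    have -> : la' = pos - neg.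
      apply/colP => i; rewrite !mxE.
      by case: (leP (la' i 0) 0); case: (leP (- la' i 0) 0); lra.
    by rewrite mulmxBr mulmx0 addr0 addrAC.
  rewrite mulmxBr !normal_ge0 ?subrr // => i;
    rewrite ?mxE ?le_max ?lexx ?orbT //.
  - by move/sla' => ->; rewrite oppr0 maxxx.
  - by move/sla' => ->; rewrite maxxx.
rewrite cjacobian_mul; apply: diff_right => //.
have feas : \forall t \near 0^'+, P (p u + t *: h).
  by apply: feasible_direction => // i /active_setP/Ah ->.
near=> t; have t0 : 0 < t by [].
apply: (@kkt_sufficient (I u) _ _ la mu) => //.
- by near: t.
- move=> i iI; split => //.
  by rewrite ray_entry Ah // mulr0 addr0 atI.
- by rewrite opprD addrACA subrr addr0.
Unshelve. all: by end_near.
Qed.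

(** Under strict complementarity the affine map [v |-> y + J_K (v - u)] keeps
    the rows in [K] tight and the others slack, and its multipliers, equal to
    [la] up to a small term, stay nonnegative; so it is the projection near
    [u]. *)
Lemma proj_near_affine K (u y : 'cV[R]_n) (la : 'cV[R]_m) (mu : 'cV[R]_l) :
  independent_rows A B K -> P y ->
  (forall i, i \in K -> 0 < la i 0 /\ (A *m y) i 0 = a i 0) ->
  (forall i, i \notin K -> (A *m y) i 0 < a i 0) -> supported K la ->
  u - y = A^T *m la + B^T *m mu ->
  differentiable p u /\ cjacobian p u = tangent_proj A B K.
Proof.
move=> indK [yA yB] laK slack sla eq_u; set J := tangent_proj A B K.
apply: (@locally_affine_diff _ _ _ _ _ y).
have [S [T ST]] := tangent_proj_residual A B K.
have nearA : \forall v \near u, forall i, i \notin K ->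
    (A *m (y + J *m (v - u))) i 0 < a i 0.
  apply: (@filter_forall _ _ _ (nbhs u)) => i; have [iK|iK] := boolP (i \in K).
    exact: nearW.
  have s0 : 0 < a i 0 - (A *m y) i 0 by rewrite subr_gt0 slack.
  apply: filterS (near_mulmx_small (A *m J) u i s0) => v lt_v _.
  by rewrite mulmxDr mxE mulmxA -ltrBrDl (le_lt_trans (ler_norm _)).
have nearS : \forall v \near u, forall i, i \in K ->
    0 < (la + S *m (v - u)) i 0.
  apply: (@filter_forall _ _ _ (nbhs u)) => i.
  have [iK|iK] := boolP (i \in K); last exact: nearW.
  have [la0 _] := laK i iK.
  apply: filterS (near_mulmx_small S u i la0) => v.
  rewrite ltr_norml => /andP[lt_v _] _.
  by rewrite mxE -ltrBlDl sub0r.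
apply: filterS2 nearA nearS => v vA vS.
have [sS eq_v] := ST (v - u).
have AK i : i \in K -> (A *m (y + J *m (v - u))) i 0 = a i 0.
  move=> iK; rewrite mulmxDr mxE tangent_proj_active // addr0.
  by have [] := laK i iK.
apply: (@kkt_sufficient K _ _ (la + S *m (v - u)) (mu + T *m (v - u))).
- split; last by rewrite mulmxDr yB tangent_proj_eqs // addr0.
  by move=> i; have [/AK ->|/vA/ltW] := boolP (i \in K).
- by move=> i iK; rewrite mxE sla // sS // addr0.
- by move=> i iK; split; [apply/ltW/vS|exact: AK].
- rewrite (mulmxDr A^T) (mulmxDr B^T) addrACA -eq_u -eq_v.
  by apply/colP => i; rewrite !mxE; ring.
Qed.

(** A row with slack at [p x] keeps it near [x], as [p] is continuous. *)
Lemma active_set_near (x : 'cV[R]_n) : \forall u \near x, I u \subset I x.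
Proof.
have : \forall u \near x, forall i, i \notin I x -> i \notin I u.
  apply: (@filter_forall _ _ _ (nbhs x)) => i.
  have [iI|iI] := boolP (i \in I x); first exact: nearW.
  have cvgA : (A *m p u) i 0 @[u --> x] --> (A *m p x) i 0.
    apply: (@cvg_entry R _ (nbhs x)).
    apply: (@cvg_mulmx R _ (nbhs x) _ _ _ _ A p).
    exact: proj_cvg.
  have near_lt : \forall u \near x, (A *m p u) i 0 < a i 0.
    by apply: cvgr_lt cvgA _ (active_setPn iI).
  by apply: (filterS _ near_lt) => u lt_i _; apply/negP => /active_setP eq_i;
    rewrite eq_i ltxx in lt_i.
apply: filterS => u Iu; apply/fintype.subsetP => i.
by apply: contraLR; exact: Iu.
Qed.

(** Complementary slackness is a sum of terms of one sign that vanishes, hence a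
    condition on the support of [la]. *)
Lemma kkt_multipliersP x la mu : KKT_multipliers A a B b x (la, mu) <->
  [/\ supported (I x) la, forall i, 0 <= la i 0 &
      x - p x = A^T *m la + B^T *m mu].
Proof.
have [pA pB] := proj_in x; rewrite /KKT_multipliers /=.
have slackE : (la^T *m (A *m p x - a)) 0 0 =
    \sum_i la i 0 * ((A *m p x) i 0 - a i 0).
  by rewrite -/(dot _ _) dotE; apply: eq_bigr => i _; rewrite !mxE.
split=> [[stat _ _ la0 compl]|[sla la0 stat]]; split => //.
- move=> i iI; have slack_i := active_setPn iI.
  move/eqP: slackE; rewrite compl mxE eq_sym.
  rewrite (eq_bigr (fun j => - (la j 0 * (a j 0 - (A *m p x) j 0)))); last first.
    by move=> j _; ring.
  rewrite sumrN oppr_eq0 psumr_eq0 => [/allP/(_ i)|j _]; last first.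
    by rewrite mulr_ge0 // subr_ge0.
  rewrite mem_index_enum => /(_ isT)/=; rewrite mulf_eq0 => /orP[/eqP //|].
  by rewrite subr_eq0 => /eqP eq_i; rewrite eq_i ltxx in slack_i.
- apply/eqP; rewrite -subr_eq0 -oppr_eq0; move/eqP: stat; congr (_ == _).
  by apply/colP => i; rewrite !mxE; ring.
- by rewrite -addrA -stat; apply/colP => i; rewrite !mxE; ring.
- by move=> i; rewrite mxE [X in _ + X]mxE subr_le0.
- apply/colP => i; rewrite !ord1 slackE mxE big1 // => j _.
  have [/active_setP ->|/sla ->] := boolP (j \in I x); last by rewrite mul0r.
  by rewrite subrr mulr0.
Qed.

(** The multipliers at [x] serve as witnesses for all nearby active sets:
    positive multipliers at [x] stay positive at [u], and a positive multiplier
    at [u] belongs to an active row. *)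
Lemma active_set_HS_index_near (x : 'cV[R]_n) : independent_rows A B (I x) ->
  \forall u \near x, HS_index A a B b x (I u).
Proof.
move=> indI; have [la [mu kkt]] := kkt_necessary indI.
have [sla la0 eq_x] := kkt.
have [L HL] := multiplier_readout indI.
have nearS : \forall u \near x, forall i, 0 < la i 0 ->
    0 < (L *m (u - p u)) i 0.
  apply: (@filter_forall _ _ _ (nbhs x)) => i.
  have [lai|lai] := boolP (0 < la i 0); last exact: nearW.
  have cvgL : (L *m (u - p u)) i 0 @[u --> x] --> (L *m (x - p x)) i 0.
    apply: (@cvg_entry R _ (nbhs x)).
    apply: (@cvg_mulmx R _ (nbhs x) _ _ _ _ L (fun u => u - p u)).
    by apply: (@cvgB _ _ _ (nbhs x)); [exact: cvg_id|exact: proj_cvg].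
  rewrite eq_x HL // in cvgL.
  have near_gt : \forall u \near x, 0 < (L *m (u - p u)) i 0.
    by apply: cvgr_gt cvgL _ lai.
  by apply: (filterS _ near_gt) => u.
apply: filterS2 (active_set_near x) nearS => u Iu posu.
have indu := independent_rows_subset Iu indI.
split; last exact/Hmx_rank.
exists (la, mu); split => //; first exact/kkt_multipliersP.
apply/fintype.subsetP => i; rewrite inE => /posu.
have [lau [muu [slau _ ->]]] := kkt_necessary indu.
rewrite HL; last exact: supported_subset slau.
by apply: contraLR => /slau ->; rewrite ltxx.
Qed.

(** The step [w] has two parts: [d] moves the projected point, making exactly
    the rows outside [K] slack, and the sum of the rows in [K] raises all
    multipliers on [K] above zero. *)
Lemma HS_index_approx (x : 'cV[R]_n) K : independent_rows A B (I x) ->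
  HS_index A a B b x K -> exists w : 'cV[R]_n,
  \forall t \near 0^'+, differentiable p (x + t *: w) /\
     cjacobian p (x + t *: w) = tangent_proj A B K.
Proof.
move=> indI [[[la mu] [/kkt_multipliersP[sla la0 eq_x] /= suppK KI]] _].
have indK := independent_rows_subset KI indI.
have laK : supported K la.
  move=> i iK; apply/eqP; rewrite eq_le la0 andbT leNgt.
  by apply: contra iK => lai; apply: (fintype.subsetP suppK); rewrite inE.
pose e : 'cV[R]_m := \col_i (i \in K)%:R.
(* d has value 0 on the rows in K and -1 on the other active rows. *)
have [d [dA dB]] := independent_rows_surj (e - const_mx 1) indI.
have dK i : i \in K -> (A *m d) i 0 = 0.
  by move=> iK; rewrite dA ?(fintype.subsetP KI) // !mxE iK subrr.
exists (d + A^T *m e).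
have slack : \forall t \near 0^'+, forall i, i \notin K ->
    (A *m (p x + t *: d)) i 0 < a i 0.
  apply: filter_forall => i.
  have [iK|iK] := boolP (i \in K); first exact: nearW.
  have [iI|/active_setPn lt_i] := boolP (i \in I x); last first.
    by apply: filterS (slack_direction d lt_i) => t.
  near=> t => _; have t0 : 0 < t by [].
  rewrite ray_entry.
  have -> : (A *m d) i 0 = - 1 by rewrite dA // !mxE (negPf iK) sub0r.
  by have /active_setP -> := iI; lra.
near=> t; have t0 : 0 < t by [].
have lt_a i : i \notin K -> (A *m (p x + t *: d)) i 0 < a i 0.
  move: i; near: t; exact: slack.
have eq_a i : i \in K -> (A *m (p x + t *: d)) i 0 = a i 0.
  move=> iK; rewrite ray_entry dK // mulr0 addr0.
  exact/active_setP/(fintype.subsetP KI).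
apply: (@proj_near_affine K _ (p x + t *: d) (la + t *: e) mu) => //.
- have [_ pB] := proj_in x; split; last first.
    by rewrite mulmxDr -scalemxAr dB scaler0 addr0.
  by move=> i; have [/eq_a ->|/lt_a/ltW] := boolP (i \in K).
- move=> i iK; split; last exact: eq_a.
  by rewrite !mxE iK mulr1 ltr_wpDl.
- by move=> i iK; rewrite !mxE laK // (negPf iK) mulr0 addr0.
- rewrite mulmxDr -scalemxAr [RHS]addrAC -eq_x.
  by apply/colP => i; rewrite !mxE; ring.
Unshelve. all: by end_near.
Qed.

End Polyhedron.

(** * Comparison of the two generalized Jacobians *)

Lemma HS_jacobian_closed (R : realType) (m n l : nat) (A : 'M[R]_(m, n))
    (a : 'cV[R]_m) (B : 'M[R]_(l, n)) (b : 'cV[R]_l) (x : 'cV[R]_n) :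
  closed (HS_jacobian A a B b x).
Proof.
apply: (accessible_finite_set_closed.1
  (hausdorff_accessible (@norm_hausdorff _ 'M[R]_n))).
have -> : HS_jacobian A a B b x = tangent_proj A B @` HS_index A a B b x.
  rewrite predeqE => J; split=> [[K HK ->]|[K HK <-]]; by exists K.
exact/finite_image/finite_finset.
Qed.

Lemma Bsubdifferential_ray (R : realType) (n p : nat)
    (f : 'cV[R]_n -> 'cV[R]_p) (x w : 'cV[R]_n) (J : 'M[R]_(p, n)) :
  (\forall t \near 0^'+, differentiable f (x + t *: w) /\
     cjacobian f (x + t *: w) = J) ->
  Bsubdifferential f x J.
Proof.
move=> /nbhs_ballP[/= e e0 eJ].
pose t k : R := e / 2 * harmonic k.
have tJ k : differentiable f (x + t k *: w) /\ cjacobian f (x + t k *: w) = J.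
  have t0 : 0 < t k by rewrite mulr_gt0 ?divr_gt0 // harmonic_gt0.
  apply: eJ => //; rewrite -ball_normE /= sub0r normrN gtr0_norm //.
  rewrite /t -[ltRHS]mulr1 -mulrA ltr_pM2l //= -invfM invf_lt1 //.
  by rewrite -natrM ltr1n mul2n doubleS.
exists (fun k => x + t k *: w); split.
- rewrite -[X in _ --> X]addr0 -(scale0r w) -(mulr0 (e / 2)).
  apply: cvgD; first exact: cvg_cst.
  apply: cvgZr_tmp; apply: cvgM; first exact: cvg_cst.
  exact: cvg_harmonic.
- by move=> k; have [] := tJ k.
- rewrite (_ : (fun k => _) = cst J); first exact: cvg_cst.
  by apply/funext => k; have [] := tJ k.
Qed.

Theorem theorem1 (R : realType) (m n l : nat) (A : 'M[R]_(m, n))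
    (a : 'cV[R]_m) (B : 'M[R]_(l, n)) (b : 'cV[R]_l) (x : 'cV[R]_n)
    (B_full_row_rank : row_free B)
    (P_nonempty : polyhedron A a B b !=set0)
    (licq : LICQ A a B b x) :
  Bsubdifferential (euclid_proj (polyhedron A a B b)) x = HS_jacobian A a B b x.
Proof.
rewrite predeqE => J; split=> [[u [ux du Ju]]|[K HK ->]].
  have near_HS : \forall k \near \oo,
      HS_index A a B b x (active_set A a B b (u k)).
    exact: ux _ (active_set_HS_index_near P_nonempty licq).
  apply: (closed_cvg (FF := eventually_filter) _
    (@HS_jacobian_closed _ _ _ _ A a B b x) _ _ Ju).
  apply: filterS near_HS => k HSk; exists (active_set A a B b (u k)) => //.
  by apply: cjacobian_proj => //; have [_ /Hmx_rank] := HSk.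
have [w near_w] := HS_index_approx P_nonempty licq HK.
exact: Bsubdifferential_ray near_w.
Qed.
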